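(* Let $Q$ be a Dyck path with $k$ factors $F_1,\ldots,F_k$, where $F_i$ has $n_i$ ascents for $i=1,\ldots,k$. Then the number of Dyck paths covered by $Q$ in the Dyck pattern poset is $$\frac{\sum_{i=1}^k n_i^2+\left(\sum_{i=1}^k n_i\right)^2}{2}-|UDU|-|DUD|,$$ where $|UDU|$ and $|DUD|$ denote the numbers of occurrences in $Q$ of the consecutive factors $UDU$ and $DUD$, respectively.
   Context: A Dyck path of semilength $n$ is a word of length $2n$ on the alphabet $\{U,D\}$ with $n$ letters $U$ and $n$ letters $D$ in which every prefix contains at least as many $U$'s as $D$'s. Equivalently, it is a lattice path with steps $U=(1,1)$ and $D=(1,-1)$ from the origin to the $x$-axis never going below the $x$-axis. The Dyck pattern poset is the set of all Dyck paths (including the empty path) with $P\le Q$ if and only if $P$ is a (not necessarily contiguous) subword, i.e. subsequence, of $Q$. It is ranked, with the rank of a path equal to its semilength. $Q$ covers $P$ (equivalently, $P$ is covered by $Q$) if $P\le Q$ and $\mathrm{rank}(P)=\mathrm{rank}(Q)-1$. If $p_0,p_1,\ldots,p_k$ are the points of $Q$ lying on the $x$-axis, listed from left to right, then the factors of $Q$ are the $k$ Dyck subpaths $F_1,\ldots,F_k$, with $F_i$ going from $p_{i-1}$ to $p_i$. An ascent is a maximal consecutive run of $U$ steps. The quantities $|UDU|$ and $|DUD|$ count the positions of $Q$ (viewed as a word) at which three consecutive letters read $UDU$, respectively $DUD$; overlapping occurrences are all counted. *)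

(* Defs.v *)
From HB Require Import structures.
From mathcomp Require Import all_boot all_order.
From mathcomp Require Import finmap.
From mathcomp Require Import classical_sets cardinality.

Set Implicit Arguments.
Unset Strict Implicit.
Unset Printing Implicit Defensive.

Import Order.TTheory.

Variant step := U | D.

Definition bool_of_step (x : step) : bool := if x is U then true else false.
Definition step_of_bool (b : bool) : step := if b then U else D.

Lemma bool_of_stepK : cancel bool_of_step step_of_bool.
Proof. by case. Qed.

HB.instance Definition _ := Countable.copy step (can_type bool_of_stepK).

Definition is_dyck (w : seq step) : bool :=
  (count_mem U w == count_mem D w) &&
  all (fun i => count_mem D (take i w) <= count_mem U (take i w))
      (iota 0 (size w).+1).

Record dyck := Dyck { word :> seq step; _ : is_dyck word }.

HB.instance Definition _ := [isSub for word].
HB.instance Definition _ := [Choice of dyck by <:].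

Definition semilength (P : dyck) : nat := count_mem U P.

Definition dyck_le (P Q : dyck) : bool := subseq P Q.

Fact dyck_display : Order.disp_t. Proof. exact: (Order.Disp tt tt). Qed.

Lemma dyck_le_refl : reflexive dyck_le.
Proof. by move=> P; apply: subseq_refl. Qed.

Lemma dyck_le_anti : antisymmetric dyck_le.
Proof.
move=> P Q /andP[PQ QP]; apply: val_inj; apply/eqP.
by rewrite -(size_subseq_leqif PQ) eqn_leq !size_subseq.
Qed.

Lemma dyck_le_trans : transitive dyck_le.
Proof. by move=> Q P R; apply: subseq_trans. Qed.

HB.instance Definition _ := Order.Le_isPOrder.Build dyck_display dyck
  dyck_le_refl dyck_le_anti dyck_le_trans.

(* The rank condition is written with a successor, so that the truncated
   predecessor on nat plays no role when Q is empty. *)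
Definition covered_by (Q : dyck) : set dyck :=
  [set P | (P <= Q)%O /\ (semilength P).+1 = semilength Q]%classic.

(* The letters of w at positions i, i+1, ..., j-1. *)
Definition slice (w : seq step) (i j : nat) : seq step := drop i (take j w).

(* Abscissas, from left to right, of the points of w on the x-axis; the first
   one is always 0. *)
Definition axis_points (w : seq step) : seq nat :=
  [seq i <- iota 0 (size w).+1
     | count_mem U (take i w) == count_mem D (take i w)].

Definition factors (Q : dyck) : seq (seq step) :=
  pairmap (slice Q) 0 (behead (axis_points Q)).

(* A run is encoded by its endpoints (i, j), and consists of the letters at
   positions i, ..., j-1. *)
Definition U_runs (w : seq step) : seq (nat * nat) :=
  [seq r <- [seq (i, j) | i <- iota 0 (size w).+1, j <- iota 0 (size w).+1]
     | (r.1 < r.2) && all (pred1 U) (slice w r.1 r.2)].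

Definition ascents (w : seq step) : seq (nat * nat) :=
  [seq r <- U_runs w
     | all (fun r' => (r'.1 <= r.1) && (r.2 <= r'.2) ==> (r' == r))
           (U_runs w)].

Definition occurrences (p w : seq step) : nat :=
  count (fun i => prefix p (drop i w)) (iota 0 (size w)).

(* Main.v *)
(* A covered path is obtained by deleting one U and one D, so it suffices to
   count the distinct results. Reading Q from left to right, at the first
   position where the result departs from Q (or has ended) the letter of Q has
   been deleted and its next letter is the opposite one. At a peak UD, the D to
   delete lies further on in the same factor, and distinct results correspond
   to the runs of D's that remain there after the peak; at a valley DU, any
   later U may be deleted, and distinct results correspond to the runs of U's
   that remain in Q after the valley. Hence the t-th peak of a factor with n
   ascents contributes n - t + 1, less one if it begins an occurrence of UDU
   (a final UD returning to the axis contributes the result that has ended),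
   and the t-th of the m - 1 valleys contributes m - t, less one if it begins
   an occurrence of DUD, where m is the number of ascents of Q. *)
Require Import Defs.
From HB Require Import structures.
From mathcomp Require Import all_boot all_order all_algebra.
From mathcomp Require Import finmap zify ring.
From mathcomp Require Import classical_sets cardinality.

Set Implicit Arguments.
Unset Strict Implicit.
Unset Printing Implicit Defensive.

Import Order.TTheory GRing.Theory Num.Theory.

(** * Paths descending to the axis from an arbitrary height *)

Definition starts (a : step) (w : seq step) : bool := ohead w == Some a.

(** The starting height is a parameter because a tail of a Dyck path need not start on the axis. *)
Fixpoint dyck_from (h : nat) (w : seq step) : bool :=
  match w, h with
  | [::], _ => h == 0
  | U :: w', _ => dyck_from h.+1 w'
  | D :: w', h'.+1 => dyck_from h' w'
  | D :: _, 0 => false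
  end.

Lemma dyck_from_count h w : dyck_from h w -> h + count_mem U w = count_mem D w.
Proof.
elim: w h => [|[] w IH] h /=; first by move/eqP->.
  by move/IH => /=; lia.
by case: h => // h /IH => /=; lia.
Qed.

Lemma dyck_from_inj h h' w : dyck_from h w -> dyck_from h' w -> h = h'.
Proof. by move=> /dyck_from_count ? /dyck_from_count ?; lia. Qed.

Lemma dyck_fromE h w :
  dyck_from h w =
  (h + count_mem U w == count_mem D w) &&
  all (fun i => count_mem D (take i w) <= h + count_mem U (take i w))
      (iota 0 (size w).+1).
Proof.
elim: w h => [|a w IH] h; first by rewrite /= addn0 andbT.
set P := (X in _ = _ && all X _).
have -> : all P (iota 0 (size (a :: w)).+1) =
          all (fun i => P i.+1) (iota 0 (size w).+1).
  have -> : iota 0 (size (a :: w)).+1 = 0 :: map S (iota 0 (size w).+1).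
    by rewrite -(iotaDl 1 0).
  by rewrite -cat1s all_cat all_map all_seq1 /P take0.
case: a @P => [|] P.
  rewrite [LHS]IH; congr (_ && _); first by rewrite /= addnS.
  by apply: eq_all => i; rewrite /P /= addnS.
case: h @P => [|h] P; first by rewrite /P /= take0 andbF.
by rewrite [LHS]IH; congr (_ && _).
Qed.

Lemma is_dyckE w : is_dyck w = dyck_from 0 w.
Proof. by rewrite dyck_fromE. Qed.

(* The subwords of w with k letters fewer that are paths from height h to 0.
   Those beginning with the first letter of w come from its tail; for the
   others that first letter is deleted. This makes the list duplicate-free. *)
Fixpoint deletions (k h : nat) (w : seq step) : seq (seq step) :=
  match w with
  | [::] => if (k == 0) && (h == 0) then [:: [::]] else [::]
  | a :: w' =>
      match a, h with
      | U, _ => map (cons U) (deletions k h.+1 w')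
      | D, h'.+1 => map (cons D) (deletions k h' w')
      | D, 0 => [::]
      end ++
      if k is k'.+1 then [seq v <- deletions k' h w' | ~~ starts a v] else [::]
  end.

(** * Correctness of the enumeration of subwords *)

Lemma mem_map_cons (a b : step) v (s : seq (seq step)) :
  (b :: v \in map (cons a) s) = (b == a) && (v \in s).
Proof.
apply/mapP/andP => [[u us [-> ->]]|[/eqP-> vs]]; first by rewrite eqxx.
by exists v.
Qed.

Lemma nil_map_cons (a : step) (s : seq (seq step)) :
  ([::] \in map (cons a) s) = false.
Proof. by apply/mapP => -[]. Qed.

(** A subword beginning with the first letter of [w] can be matched using that letter; any other
    subword must have lost it. *)
Lemma mem_deletions k h w v :
  (v \in deletions k h w) =
  [&& subseq v w, size v + k == size w & dyck_from h v].
Proof.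
elim: w k h v => [|a w IH] k h v.
  by case: k h v => [|k] [|h] [|[] v].
rewrite /= mem_cat; case: v => [|b v].
  have -> : ([::] \in match a, h with
      | U, _ => map (cons U) (deletions k h.+1 w)
      | D, h'.+1 => map (cons D) (deletions k h' w)
      | D, 0 => [::]
      end) = false by case: a h => [] [|h]; rewrite ?nil_map_cons.
  by case: k => [|k]; rewrite //= mem_filter IH /= sub0seq add0n eqSS.
have [->|ba] /= := eqVneq b a.
  have -> : (a :: v \in (if k is k'.+1
      then [seq v <- deletions k' h w | ~~ starts a v] else [::])) = false.
    by case: k => // k; rewrite mem_filter /starts /= eqxx.
  rewrite orbF addSn eqSS.
  by case: a h => [] [|h]; rewrite ?mem_map_cons ?eqxx ?IH ?andbF.
have -> : (b :: v \in match a, h with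
      | U, _ => map (cons U) (deletions k h.+1 w)
      | D, h'.+1 => map (cons D) (deletions k h' w)
      | D, 0 => [::]
      end) = false.
  by case: a h ba => [] [|h] // ba; rewrite mem_map_cons (negbTE ba).
case: k => [|k] /=.
  rewrite in_nil addn0 eqSS; apply/esym/negbTE/and3P => -[/size_subseq /=].
  by rewrite ltnNge => /negP vw /eqP vE; case: vw; rewrite vE.
rewrite mem_filter IH /starts /= (inj_eq Some_inj) ba /= addnS !eqSS.
by rewrite addSn.
Qed.

Lemma deletions_uniq k h w : uniq (deletions k h w).
Proof.
elim: w k h => [|a w IH] k h /=; first by case: ifP.
rewrite cat_uniq; apply/and3P; split.
- by case: a h => [] [|h] //=; rewrite map_inj_uniq // => u v [].
- case: k => // k; apply/hasPn => v; rewrite mem_filter => /andP[av _].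
  by case: a h av => [] [|h] //; case: v => [|b v] av;
    rewrite ?nil_map_cons // mem_map_cons;
    apply: contra av => /andP[/eqP-> _]; rewrite /starts.
- by case: k => // k; rewrite filter_uniq.
Qed.

Lemma deletions0 h w :
  deletions 0 h w = if dyck_from h w then [:: w] else [::].
Proof.
by elim: w h => [|[] w IH] [|h] //=; rewrite IH cats0; case: ifP.
Qed.

Lemma deletions0_eq h h' w :
  dyck_from h' w -> deletions 0 h w = if h == h' then [:: w] else [::].
Proof.
move=> hw; rewrite deletions0; case: eqP => [->|]; first by rewrite hw.
by case: ifP => // hw' /(_ (dyck_from_inj hw' hw)).
Qed.

(* Each run of U's is counted at its last letter. *)
Fixpoint runs (w : seq step) : nat :=
  if w is a :: w' then ((a == U) && ~~ starts U w') + runs w' else 0.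

(* For h > 0 the first entry is the unfinished factor, up to the first return to
   height 0. *)
Fixpoint factors_from (h : nat) (w : seq step) : seq (seq step) :=
  if w is a :: w' then
    let h' := if a == U then h.+1 else h.-1 in
    if h' == 0 then [:: a] :: factors_from 0 w'
    else (a :: head [::] (factors_from h' w')) :: behead (factors_from h' w')
  else [::].

(** * Counting one- and two-letter deletions *)

Local Notation nfirst h w := (runs (head [::] (factors_from h w))).

Lemma head_factors_from h w b :
  starts b (head [::] (factors_from h w)) = starts b w.
Proof. by case: w => //= a w; case: ifP. Qed.

Lemma startsD h w : dyck_from h.+1 w -> starts D w = ~~ starts U w.
Proof. by case: w => [|[]]. Qed.

Lemma filter_map_cons_neq (a b : step) s : a != b ->
  [seq v <- map (cons a) s | ~~ starts b v] = map (cons a) s.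
Proof.
move=> ab; apply/all_filterP/allP => v /mapP[u _ ->].
by rewrite /starts /= (inj_eq Some_inj).
Qed.

Lemma filter_map_cons_eq (a : step) s :
  [seq v <- map (cons a) s | ~~ starts a v] = [::].
Proof.
by elim: s => //= v s ->; rewrite /starts /= eqxx.
Qed.

(** Deleting a [D] lowers what precedes it by one level, so it must lie no later than the first
    return to the axis. Up to there each run of [D]'s gives one result: one run after each ascent,
    and one more if [w] begins with [D]. *)
Lemma size_deletions1D h w : dyck_from h.+1 w ->
  size (deletions 1 h w) = nfirst h.+1 w + starts D w.
Proof.
elim: w h => [|[] w IH] [|h] //= hw.
1,2: rewrite (deletions0_eq _ hw) size_cat size_map IH // head_factors_from.
1,2: by rewrite (startsD hw) ltn_eqF //= /starts /=; lia.
- by rewrite (deletions0_eq _ hw) /=; case: w hw {IH} => [|[]].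
rewrite (deletions0_eq _ hw) eqxx size_cat size_map IH //=.
by rewrite add0n addn1; case: (starts D w); rewrite /= ?addn0 ?addn1.
Qed.

(** Deleting a [U] raises what precedes it, so every run of [U]'s is available and gives one
    result. *)
Lemma size_deletions1U h w : dyck_from h w ->
  size (deletions 1 h.+1 w) = runs w.
Proof.
elim: w h => [|[] w IH] h //= hw.
  rewrite (deletions0_eq _ hw) eqxx size_cat size_map IH //=.
  by case: (starts U w); rewrite /= ?addn0 ?addn1.
case: h hw => // h hw.
by rewrite (deletions0_eq _ hw) size_cat size_map IH // gtn_eqF //= addn0.
Qed.

Lemma occurrences_cons p a w :
  occurrences p (a :: w) = prefix p (a :: w) + occurrences p w.
Proof. by rewrite /occurrences /= (iotaDl 1 0) count_map. Qed.

Lemma factors_from_cons h a w :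
  factors_from h (a :: w) =
  head [::] (factors_from h (a :: w)) :: behead (factors_from h (a :: w)).
Proof. by rewrite /=; case: ifP. Qed.

(* [starts U w] is the overlap recorded by an occurrence of UDU: deleting this
   UD, or the D together with the next U, gives the same word. *)
Lemma size_deletions1_peak h w : dyck_from h w ->
  size [seq v <- deletions 1 h (D :: w) | ~~ starts U v] + starts U w =
  (nfirst h.+1 (D :: w)).+1.
Proof.
case: h => [|h] hw; rewrite /= (deletions0_eq _ hw) eqxx /=.
  by case: w hw => [|[]].
rewrite filter_cat filter_map_cons_neq // size_cat size_map.
rewrite size_deletions1D // add0n; move: (runs (head _ _)) => m.
by case: w hw => [|[] w] //= _; rewrite /starts /= ?addn0 ?addn1.
Qed.

(** The [D] of a valley is already deleted. Each run of [U]'s gives one result, except a first run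
    of length one, whose deletion would put a [D] first. *)
Lemma size_deletions1_valley h w : dyck_from h.+1 w ->
  size [seq v <- deletions 1 h.+1 (U :: w) | ~~ starts D v] = runs w.
Proof.
move=> hw; rewrite /= (deletions0_eq _ hw) eqxx filter_cat.
rewrite filter_map_cons_neq // size_cat size_map size_deletions1U //.
by case: w hw => [|[] w] //= _; rewrite addn0.
Qed.

(** The overlaps stand on the left to avoid subtraction in [nat]. A word starting with [D] has a
    valley before each of its ascents, hence the term [~~ starts U w]. *)
Lemma size_deletions2 h w : dyck_from h w ->
  size (deletions 2 h w) + occurrences [:: U; D; U] w
    + occurrences [:: D; U; D] w
  = sumn [seq 'C((runs F).+1, 2) | F <- factors_from h w]
    + 'C(runs w + ~~ starts U w, 2).
Proof.
elim: w h => [|[] w IH] h hw; first by case: h hw.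
  have {}IH := IH h.+1 hw; rewrite !occurrences_cons.
  have -> : size (deletions 2 h (U :: w)) = size (deletions 2 h.+1 w)
      + size [seq v <- deletions 1 h w | ~~ starts U v].
    by rewrite [LHS]size_cat size_map.
  case: w hw IH => [|[] w] // hw IH.
    have hw' : dyck_from h.+2 w := hw.
    (* Departing at [UU] would delete both letters, and the path would then miss the axis at its
       end. *)
    rewrite [deletions 1 h _]/= filter_cat filter_map_cons_eq.
    rewrite (deletions0_eq _ hw') ltn_eqF //= addn0 !add0n.
    by move: IH => /= ->.
  (* A peak adds an ascent to the first factor; by Pascal's rule its binomial grows by the total of
     [size_deletions1_peak]. *)
  have hw' : dyck_from h w := hw.
  have := size_deletions1_peak hw'.
  have := head_factors_from h.+1 (D :: w) U.
  have -> : factors_from h (U :: D :: w) =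
    (U :: head [::] (factors_from h.+1 (D :: w)))
      :: behead (factors_from h.+1 (D :: w)) by [].
  rewrite factors_from_cons in IH; move: IH.
  move: (head _ _) (behead _) (size (filter _ _)) => f fs m IH Uf Em.
  have runsUD : runs (U :: D :: w) = (runs (D :: w)).+1 by [].
  have runsUf : runs (U :: f) = (runs f).+1 by rewrite /= Uf.
  have UDU : prefix [:: U; D; U] (U :: D :: w) = starts U w.
    by case: (w) => [|[] u] //=; rewrite prefix0s.
  rewrite runsUD [in RHS]/= -/(runs (U :: f)) runsUf.
  rewrite [prefix [:: D; U; D] _]/= UDU binS bin1.
  move: IH; rewrite [in RHS]/= addn1 addn0 => IH.
  by lia.
case: h hw => // h hw.
have {}IH := IH h hw; rewrite !occurrences_cons.
have -> : size (deletions 2 h.+1 (D :: w)) = size (deletions 2 h w)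
    + size [seq v <- deletions 1 h.+1 w | ~~ starts D v].
  by rewrite [LHS]size_cat size_map.
(* A leading [D] adds no ascent; if it is a whole factor, that factor contributes ['C(1, 2) = 0]. *)
have -> : sumn [seq 'C((runs F).+1, 2) | F <- factors_from h.+1 (D :: w)] =
          sumn [seq 'C((runs F).+1, 2) | F <- factors_from h w].
  case: h hw {IH} => [|h] //=; case: w => // a w _.
  by rewrite (factors_from_cons h.+1 a w).
case: w hw IH => [|[] w] hw IH; first by case: h hw {IH}.
  have hw' : dyck_from h.+1 w := hw.
  rewrite size_deletions1_valley //.
  have DUD : prefix [:: D; U; D] (D :: U :: w) = ~~ starts U w.
    by rewrite -(startsD hw') /=; case: (w) => [|[] u] //=; rewrite prefix0s.
  have Er : runs (U :: w) = ~~ starts U w + runs w by [].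
  have -> : runs (D :: U :: w) + ~~ starts U (D :: U :: w) = (runs (U :: w)).+1.
    by rewrite addn1.
  rewrite binS bin1 DUD [prefix [:: U; D; U] _]/=.
  by move: IH; rewrite [in RHS]addn0; lia.
case: h hw IH => // h hw IH; have hw' : dyck_from h w := hw.
rewrite [deletions 1 _ _]/= filter_cat filter_map_cons_eq.
by rewrite (deletions0_eq _ hw') gtn_eqF //= addn0 !add0n; move: IH => /= ->.
Qed.

(** * Recursive factors against factors cut at axis points *)

Lemma sum_runs_factors_from h w : dyck_from h w ->
  sumn (map runs (factors_from h w)) = runs w.
Proof.
have sumn_split (s : seq (seq step)) :
  runs (head [::] s) + sumn (map runs (behead s)) = sumn (map runs s).
  by case: s.
elim: w h => [|[] w IH] h //= hw.
  by rewrite head_factors_from -addnA sumn_split IH.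
case: h hw => // h hw; rewrite !add0n -(IH h hw) /=.
by case: eqP => [->|_] //=; rewrite add0n sumn_split.
Qed.

(** The starting point is left out, matching the [behead] in [factors]. *)
Definition axis_points_from h w := [seq i <- iota 1 (size w)
   | h + count_mem U (take i w) == count_mem D (take i w)].

Lemma pairmap_slice_cons a w x l :
  pairmap (slice (a :: w)) x.+1 (map S l) = pairmap (slice w) x l.
Proof. by elim: l x => //= y l IH x; rewrite IH. Qed.

Lemma pairmap_axis_points_from h w : dyck_from h w ->
  pairmap (slice w) 0 (axis_points_from h w) = factors_from h w.
Proof.
elim: w h => [|a w IH] h //= hw.
set h' := if a == U then _ else _.
have hw' : dyck_from h' w by case: a @h' hw => //; case: h.
have -> : axis_points_from h (a :: w) =
  (if h' == 0 then [:: 1] else [::]) ++ map S (axis_points_from h' w).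
  rewrite /axis_points_from [size _]/= [iota 1 _]/= (iotaDl 1 1).
  rewrite /= filter_map take0.
  have -> : (h + ((a == U) + count_mem U [::]) ==
             (a == D) + count_mem D [::]) = (h' == 0).
    rewrite /h'; case: a hw {h' hw'} => /= hw; first by lia.
    by case: h hw => // h _ /=; lia.
  rewrite (_ : filter _ _ = [seq i <- iota 1 (size w) |
    h' + count_mem U (take i w) == count_mem D (take i w)]).
    by case: ifP.
  apply: eq_filter => i; case: a @h' hw {hw'} => /= [|]; first by rewrite addnS.
  by case: h.
have {}IH := IH _ hw'.
case: eqP => [h0|/eqP h0].
  have -> : factors_from 0 w = factors_from h' w by rewrite h0.
  by rewrite -IH /= pairmap_slice_cons /slice /= take0.
(* As [h'] is nonzero, the rest of the path is nonempty and still has to reach the axis. *)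
rewrite -IH; case: axis_points_from IH => [|x l] IH.
  by case: w hw' h0 IH {hw} => [/eqP->//|b w] _ _; rewrite factors_from_cons.
by rewrite /= pairmap_slice_cons /slice /= drop0.
Qed.

Lemma factorsE (Q : dyck) : factors Q = factors_from 0 Q.
Proof.
rewrite -pairmap_axis_points_from -?is_dyckE; last by case: Q.
by rewrite /factors /axis_points /= take0.
Qed.

(** * Ascents as maximal runs *)

Lemma mem_U_runs w i j :
  ((i, j) \in U_runs w) =
  [&& i < j, j <= size w & all (pred1 U) (slice w i j)].
Proof.
rewrite mem_filter /=; case: ltnP => //= ij.
have -> : ((i, j) \in [seq (i, j) | i <- iota 0 (size w).+1,
                          j <- iota 0 (size w).+1]) = (j <= size w).
  apply/allpairsP/idP => [[[x y] [_ yw [_ ->]]]|jw].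
    by move: yw; rewrite mem_iota.
  by exists (i, j); rewrite !mem_iota; split=> //=; lia.
by rewrite andbC.
Qed.

Lemma slice_all w i j : j <= size w ->
  reflect (forall l, i <= l < j -> nth D w l = U) (all (pred1 U) (slice w i j)).
Proof.
move=> jw; have sz : size (slice w i j) = j - i.
  by rewrite /slice size_drop size_takel.
apply: (iffP (all_nthP D)) => H l Hl.
  have := H (l - i); rewrite sz /slice nth_drop nth_take; last by lia.
  by rewrite subnKC; [move=> E; apply/eqP/E|]; lia.
rewrite sz in Hl; rewrite /slice nth_drop nth_take; last by lia.
by apply/eqP/H; lia.
Qed.

(** The default letter [D] closes a run that reaches the end of [w]. *)
Definition run_end w j := [&& 0 < j, nth D w j.-1 == U & nth D w j != U].

Lemma count_run_end w : count (run_end w) (iota 0 (size w).+1) = runs w.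
Proof.
have -> : count (run_end w) (iota 0 (size w).+1) =
   count (fun j => (nth D w j == U) && (nth D w j.+1 != U)) (iota 0 (size w)).
  by rewrite [LHS]/= add0n (iotaDl 1 0) count_map; apply: eq_count.
elim: w => //= a w <-; rewrite (iotaDl 1 0) count_map.
by congr (_ + _); case: w => [|[]].
Qed.

Lemma mem_ascents_end w i j : (i, j) \in ascents w -> run_end w j.
Proof.
rewrite mem_filter mem_U_runs => /andP[/allP maxij /and3P[ij jw]].
move=> /(slice_all _ jw) aU; apply/and3P; split; first by lia.
  by apply/eqP/aU; lia.
apply/negP => /eqP jU.
have jw' : j < size w.
  by rewrite ltnNge; apply/negP => wj; move: jU; rewrite nth_default.
have : (i, j.+1) \in U_runs w.
  rewrite mem_U_runs jw' ltnS ltnW //; apply/slice_all => // l Hl.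
  by have [->//|lj] := eqVneq l j; apply: aU; lia.
by move=> /maxij /=; rewrite leqnn leqnSn /= xpair_eqE; lia.
Qed.

(** The least possible start makes the run maximal on the left; [run_end] makes it maximal on the
    right. *)
Lemma run_end_ascent w j : run_end w j -> exists i, (i, j) \in ascents w.
Proof.
case/and3P => j0 jU jD.
have jw : j <= size w.
  by rewrite leqNgt; apply/negP => wj; move: jU; rewrite nth_default //; lia.
pose p i := (i < j) && all (pred1 U) (slice w i j).
have exp : exists i, p i.
  exists j.-1; apply/andP; split; first by lia.
  apply/slice_all => // l Hl; have -> : l = j.-1 by lia.
  exact/eqP.
case: (ex_minnP exp) => i /andP[ij aU] mini; exists i.
rewrite mem_filter mem_U_runs ij jw aU !andbT; apply/allP => -[i' j'] /=.
rewrite mem_U_runs => /and3P[ij' jw' /(slice_all _ jw') aU'].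
apply/implyP => /andP[ii jj]; rewrite xpair_eqE.
have Ej : j' = j.
  apply/eqP; rewrite eqn_leq jj andbT leqNgt; apply/negP => jj'.
  by move: jD; rewrite aU' ?eqxx //; lia.
have /mini : p i'.
  apply/andP; split; first by lia.
  by apply/slice_all => // l Hl; apply: aU'; lia.
by rewrite Ej; lia.
Qed.

(** Two runs with the same right end are nested, so maximality makes them equal. *)
Lemma ascents_end_inj w : {in ascents w &, injective snd}.
Proof.
move=> [i j] [i' j'] Hi Hi' /= Ej; rewrite -{}Ej in Hi' *.
move: Hi Hi'; rewrite !(mem_filter _ _ (U_runs w)).
move=> /andP[/allP M R] /andP[/allP M' R'].
have [ii|/ltnW ii] := leqP i i'.
  by have := M' _ R; rewrite /= ii leqnn => /eqP.
by have := M _ R'; rewrite /= ii leqnn => /eqP.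
Qed.

Lemma size_ascents w : size (ascents w) = runs w.
Proof.
rewrite -count_run_end -size_filter -(size_map snd); apply/perm_size/uniq_perm.
- rewrite map_inj_in_uniq; last exact: ascents_end_inj.
  by rewrite !filter_uniq // allpairs_uniq ?iota_uniq // => -[? ?] [].
- by rewrite filter_uniq ?iota_uniq.
move=> j; rewrite mem_filter mem_iota; apply/mapP/andP => [[[i k] H ->]|[H _]].
  split; first exact: mem_ascents_end H.
  by move: H; rewrite (mem_filter _ _ (U_runs w)) mem_U_runs => /and4P[].
by have [i Hi] := run_end_ascent H; exists (i, j).
Qed.

(** * Covered paths and the closed formula *)

Lemma size_dyck_from h w : dyck_from h w -> size w = h + (count_mem U w).*2.
Proof.
move=> /dyck_from_count E; have -> : size w = count_mem U w + count_mem D w.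
  by elim: w {E} => [|[] w IH] //=; rewrite IH ?addnS.
by rewrite -E; lia.
Qed.

Lemma covered_byE (Q : dyck) :
  covered_by Q =
  [set` [fset P in (pmap insub (deletions 2 0 Q) : seq dyck)]%fset]%classic.
Proof.
have dyckP (P : dyck) : dyck_from 0 P by rewrite -is_dyckE; case: P.
have sizeE (P : dyck) : size P = (semilength P).*2.
  by rewrite (size_dyck_from (dyckP P)).
have memE P : (P \in [fset P in (pmap insub (deletions 2 0 Q) : seq dyck)]%fset)
    = subseq P Q && ((semilength P).+1 == semilength Q).
  rewrite in_fset /= mem_pmap_sub mem_deletions dyckP andbT !sizeE.
  by rewrite addn2 -doubleS (inj_eq double_inj).
apply/seteqP; split=> P /=; rewrite memE.
  by case=> PQ /eqP ->; rewrite andbT; apply: PQ.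
by case/andP => PQ /eqP.
Qed.

(** By [2 * 'C(m, 2) + m = m ^ 2], the linear terms left by the factors complete the binomial of the
    valleys to a square. *)
Lemma double_card_deletions (Q : dyck) :
  (size (deletions 2 0 Q) + occurrences [:: U; D; U] Q
    + occurrences [:: D; U; D] Q).*2
  = \sum_(f <- factors Q) runs f ^ 2 + (\sum_(f <- factors Q) runs f) ^ 2.
Proof.
have Q0 : dyck_from 0 Q by rewrite -is_dyckE; case: Q.
have bin2E m : 'C(m, 2).*2 + m = m ^ 2.
  by elim: m => // m; rewrite binS bin1 -!mulnn; nia.
rewrite factorsE (size_deletions2 Q0) doubleD.
have -> : \sum_(f <- factors_from 0 Q) runs f
    = sumn (map runs (factors_from 0 Q)) by rewrite sumnE big_map.
have -> : (sumn [seq 'C((runs f).+1, 2) | f <- factors_from 0 Q]).*2 =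
    \sum_(f <- factors_from 0 Q) runs f ^ 2
      + sumn (map runs (factors_from 0 Q)).
  rewrite !sumnE !big_map -muln2 big_distrl -big_split /=.
  by apply: eq_bigr => f _; rewrite -bin2E binS bin1; lia.
rewrite (sum_runs_factors_from Q0) -addnA -bin2E; congr (_ + _).
(* A nonempty Dyck path starts with [U]; for the empty one both binomials vanish. *)
by case: (word Q) Q0 => [|[] w] // _; rewrite addn0 addnC.
Qed.

Local Open Scope fset_scope.
Local Open Scope ring_scope.

Theorem proposition2p1 (Q : dyck) (k : nat) (F : k.-tuple (seq step))
    (n : 'I_k -> nat)
    (hF : factors Q = F :> seq (seq step))
    (hn : forall i : 'I_k, n i = size (ascents (tnth F i))) :
  finite_set (covered_by Q) /\
  (#|` fset_set (covered_by Q)|%:R : rat) =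
    (\sum_(i < k) (n i)%:R ^+ 2 + (\sum_(i < k) (n i)%:R) ^+ 2) / 2%:R
    - (occurrences [:: U; D; U] Q)%:R - (occurrences [:: D; U; D] Q)%:R.
Proof.
rewrite covered_byE set_fsetK; split; first exact: finite_fset.
rewrite card_fseq undup_id; last by rewrite pmap_sub_uniq ?deletions_uniq.
(* Every listed word is a Dyck path, so [insub] discards none. *)
rewrite size_pmap_sub (_ : count _ _ = size (deletions 2 0 Q)); last first.
  apply/eqP; rewrite -all_count; apply/allP => v.
  by rewrite mem_deletions is_dyckE => /and3P[].
have {}hn i : n i = runs (tnth F i) by rewrite hn size_ascents.
have := double_card_deletions Q; rewrite hF !big_tuple.
move=> /(congr1 (fun m => m%:R : rat)).
rewrite -muln2 natrM !natrD natrX !natr_sum => E.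
under eq_bigr do rewrite hn -natrX.
under [X in _ + X ^+ 2]eq_bigr do rewrite hn.
by rewrite -E; field.
Qed.
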